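(* Let $\Omega$ be a Polish space and $(T_n)_{n\in\mathbb{N}}\subset\mathscr{L}(\mathscr{M}(\Omega),\sigma)$ a sequence of weakly continuous operators that is order bounded in $\mathscr{L}(\mathscr{M}(\Omega))$ (there are $R,S\in\mathscr{L}(\mathscr{M}(\Omega))$ with $R\le T_n\le S$ for all $n$). Then $\sup_n T_n$ exists in $\mathscr{L}(\mathscr{M}(\Omega))$ and is weakly continuous. In particular $\mathscr{L}(\mathscr{M}(\Omega),\sigma)$ is $\sigma$-order complete.
   Context: $\mathscr{M}(\Omega)$ is the Banach lattice of finite signed Borel measures; $\mathscr{L}(\mathscr{M}(\Omega))$ the bounded operators on it, ordered by $S\le T$ iff $S\mu\le T\mu$ for all positive $\mu$. A transition kernel is a map $k:\Omega\times\mathscr{B}(\Omega)\to\mathbb{R}$, finite signed measure in the second variable and Borel measurable in the first; bounded if $\sup_x\lvert k\rvert(x,\Omega)<\infty$. $T$ is weakly continuous if $(T\mu)(A)=\int k(x,A)\,d\mu(x)$ for some bounded transition kernel $k$; $\mathscr{L}(\mathscr{M}(\Omega),\sigma)$ is the space of weakly continuous operators. *)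

(* Defs.v *)
From HB Require Import structures.
From mathcomp Require Import all_boot all_order all_algebra.
From mathcomp Require Import all_classical all_reals all_analysis measurable_realfun.
Set Implicit Arguments. Unset Strict Implicit. Unset Printing Implicit Defensive.
Import Order.TTheory GRing.Theory Num.Theory.
Local Open Scope classical_set_scope.
Local Open Scope ring_scope.

Notation Borel X := (g_sigma_algebraType (@open X)).

Definition polish (R : realType) (X : topologicalType) : Prop :=
  (exists D : set X, countable D /\ closure D = [set: X]) /\
  exists d : X -> X -> R,
    [/\ (forall x y, 0 <= d x y),
        (forall x y, d x y = 0 <-> x = y),
        (forall x y, d x y = d y x),
        (forall x y z, d x z <= d x y + d y z) /\
        (forall U : set X, open U <->
           (forall x, U x -> exists e : R, 0 < e /\ ([set y | d x y < e] `<=` U))) &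
        (forall u : nat -> X,
           (forall e : R, 0 < e -> exists N : nat,
              forall m n : nat, (N <= m)%N -> (N <= n)%N -> d (u m) (u n) < e) ->
           exists l : X, u @ \oo --> l)].

Local Open Scope ereal_scope.

Section signed_measures.
Context (R : realType) (X : ptopologicalType).

(* M(Omega): finite signed Borel measures = charges on the Borel sigma-algebra *)
Definition SM := {charge set (Borel X) -> \bar R}.

Definition hahn_P (mu : SM) : set (Borel X) :=
  projT1 (cid (Hahn_decomposition mu)).
Definition hahn_N (mu : SM) : set (Borel X) :=
  projT1 (cid (projT2 (cid (Hahn_decomposition mu)))).
Definition hahnPN (mu : SM) : hahn_decomposition mu (hahn_P mu) (hahn_N mu) :=
  projT2 (cid (projT2 (cid (Hahn_decomposition mu)))).

Definition tvnorm (mu : SM) : \bar R := charge_variation (hahnPN mu) [set: Borel X].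

Definition sintegral (mu : SM) (f : Borel X -> \bar R) : \bar R :=
  (\int[jordan_pos (hahnPN mu)]_x f x) - (\int[jordan_neg (hahnPN mu)]_x f x).

Definition positive_sm (mu : SM) : Prop :=
  forall A, measurable A -> 0 <= mu A.

Definition op := SM -> SM.

Definition linear_op (T : op) : Prop :=
  forall (a b : R) (mu nu : SM) (A : set (Borel X)), measurable A ->
    T (cadd (cscale a mu) (cscale b nu)) A = a%:E * T mu A + b%:E * T nu A.

Definition bounded_op (T : op) : Prop :=
  linear_op T /\ exists C : R, forall mu : SM, tvnorm (T mu) <= C%:E * tvnorm mu.

Definition op_le (S T : op) : Prop :=
  forall mu : SM, positive_sm mu ->
    forall A, measurable A -> S mu A <= T mu A.

Definition bounded_kernel (k : Borel X -> SM) : Prop :=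
  (forall A : set (Borel X), measurable A -> @measurable_fun _ _ (Borel X) (\bar R) [set: Borel X] (fun x => k x A)) /\
  exists M : R, forall x, tvnorm (k x) <= M%:E.

Definition weakly_continuous (T : op) : Prop :=
  bounded_op T /\
  exists k : Borel X -> SM, bounded_kernel k /\
    forall (mu : SM) (A : set (Borel X)), measurable A ->
      T mu A = sintegral mu (fun x => k x A).

Definition is_sup_op (Tn : nat -> op) (U : op) : Prop :=
  [/\ bounded_op U, (forall n, op_le (Tn n) U) &
      (forall V, bounded_op V -> (forall n, op_le (Tn n) V) -> op_le U V)].

End signed_measures.

(* Main.v *)
(* The operators T_n have kernels k_n, and the supremum is the operator whose
   kernel at x is the supremum l(x) of the signed measures k_n(x), which exists
   since they lie between R(delta_x) and S(delta_x).  It is the limit of the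
   partial suprema m_0 = k_0, m_{n+1} = k_{n+1} \/ m_n, where
   mu \/ nu = nu + (mu - nu)^+.

   Measurability: the Borel sets of a Polish space are generated by a countable
   algebra (B_j), and by approximation nu^+(A) = sup_j nu(A `&` B_j), a countable
   supremum.

   Leastness: an upper bound V need not have a kernel.  But for mu >= 0,
   E |-> V(mu restricted to E)(A) is additive, and if an additive set function
   dominates the integral over E of each f_j, for all E, then it dominates the
   integral of sup_j f_j, because the set where f_j realises a finite maximum is
   measurable.  Apply this to f_j(x) = (k - m)(x, A `&` B_j). *)

Require Import Defs.
From HB Require Import structures.
From mathcomp Require Import all_boot all_order all_algebra.
From mathcomp Require Import all_classical all_reals all_analysis measurable_realfun.
From mathcomp Require Import lra.
(* [sintegral] is also the integral of simple functions in mathcomp-analysis. *)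
Import Defs.
Set Implicit Arguments.
Unset Strict Implicit.
Unset Printing Implicit Defensive.
Import Order.TTheory GRing.Theory Num.Theory.
Import numFieldNormedType.Exports.
Local Open Scope classical_set_scope.
Local Open Scope ring_scope.
Local Open Scope ereal_scope.

(** * Positive part of a signed measure *)

Section approximation.
Context (d : measure_display) (T : measurableType d) (R : realType).
Variables (mu : {measure set T -> \bar R}) (G : set (set T)).
Hypotheses (muF : fin_num_fun mu) (GE : @measurable _ T = <<s G >>)
  (GT : G [set: T]) (GI : setI_closed G) (GC : setC_closed G).

(** The good sets: those within any [e] of [G] in the pseudometric given by the measure of the
    symmetric difference. *)
Let approximable (P : set T) := measurable P /\
  forall e : R, (0 < e)%R -> exists2 B, G B & mu (P `+` B) < e%:E.

Let mG (B : set T) : G B -> measurable B.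
Proof. by move=> GB; rewrite GE; exact: sub_gen_smallest. Qed.

Let mY (A B : set T) : measurable A -> measurable B -> measurable (A `+` B).
Proof. by move=> mA mB; apply: measurableU; apply: measurableD. Qed.

Let approxC P : approximable P -> approximable (~` P).
Proof.
move=> [mP aP]; split; first exact: measurableC.
move=> e /aP[B GB PB]; exists (~` B); first exact: GC.
suff -> : ~` P `+` ~` B = P `+` B by [].
by rewrite /setY !setDE !setCK setUC (setIC (~` P)) (setIC (~` B)).
Qed.

Let approxU P Q : approximable P -> approximable Q -> approximable (P `|` Q).
Proof.
move=> [mP aP] [mQ aQ]; split; first exact: measurableU.
move=> e e0; have e20 : (0 < e / 2)%R by lra.
have [B GB PB] := aP _ e20; have [C GC' QC] := aQ _ e20.
exists (B `|` C).
  by rewrite -(setCK (B `|` C)) setCU; apply: GC; apply: GI; exact: GC.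
have [mB mC] := (mG GB, mG GC').
have mPB := mY mP mB; have mQC := mY mQ mC.
apply: (@le_lt_trans _ _ (mu (P `+` B) + mu (Q `+` C))); last first.
  by rewrite (splitr e) EFinD lteD.
apply: le_trans (measureU2 _ mPB mQC).
apply: le_measure; rewrite ?inE//; [|exact: measurableU|].
  by apply: mY; exact: measurableU.
by move=> x; rewrite /setY /=; tauto.
Qed.

(** By continuity from below a finite partial union already carries all but [e / 2] of the measure
    of the whole union, and that finite union is approximable within [e / 2]. *)
Let approxbigU F : (forall n : nat, approximable (F n)) ->
  approximable (\bigcup_n F n).
Proof.
move=> aF; have mF n : measurable (F n) by have [] := aF n.
have mUF : measurable (\bigcup_n F n) by exact: bigcupT_measurable.
split=> // e e0; have e20 : (0 < e / 2)%R by lra.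
pose S n := \big[setU/set0]_(i < n.+1) F i.
have aS n : approximable (S n).
  elim: n => [|n ih]; rewrite /S.
    by rewrite big_ord_recr big_ord0 /= set0U.
  by rewrite big_ord_recr /=; exact: approxU.
have mS n : measurable (S n) by have [] := aS n.
have US : \bigcup_n S n = \bigcup_n F n by exact: bigcup_bigsetU_bigcup.
have cS : mu (S n) @[n --> \oo] --> mu (\bigcup_n F n).
  rewrite -US; apply: nondecreasing_cvg_mu => //; first by rewrite US.
  by move=> a b ab; exact/subsetPset/subset_bigsetU.
have lt_UU : mu (\bigcup_n F n) - (e / 2)%:E < mu (\bigcup_n F n).
  by rewrite lteBlDr// lteDl// ?muF// lte_fin.
have [n nS] : exists n, mu (\bigcup_n F n) - (e / 2)%:E < mu (S n).
  have /cS : nbhs (mu (\bigcup_n F n))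
      [set y | mu (\bigcup_n F n) - (e / 2)%:E < y].
    apply: open_nbhs_nbhs; split; first exact: open_ereal_gt_ereal.
    exact: lt_UU.
  by case=> N _ /(_ N (leqnn _)); exists N.
have [_ /(_ _ e20)[B GB SB]] := aS n; have mB := mG GB.
exists B => //.
have SF : S n `<=` \bigcup_n F n by rewrite -US; exact: bigcup_sup.
(* Triangle inequality for symmetric differences, passing through [S n]. *)
apply: (@le_lt_trans _ _ (mu ((\bigcup_n F n) `\` S n) + mu (S n `+` B))).
  apply: le_trans (measureU2 _ _ _); [|exact: measurableD|exact: mY].
  apply: le_measure; rewrite ?inE//; [exact: mY| |].
    by apply: measurableU; [exact: measurableD|exact: mY].
  by move=> x; have := SF x; have [] := pselect (S n x); rewrite /setY /=; tauto.
rewrite (splitr e) EFinD lteD// measureD// ?setIidr//; last first.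
  by rewrite ltey_eq muF.
by rewrite lteBlDr ?muF// addeC -lteBlDr.
Qed.

(** The approximable sets form a sigma-algebra containing [G], hence contain every measurable
    set. *)
Lemma measurable_approx (P : set T) (e : R) : measurable P -> (0 < e)%R ->
  exists2 B, G B & mu (P `+` B) < e%:E.
Proof.
move=> mP; suff [_ /(_ e)] : approximable P by [].
have aT : approximable [set: T].
  by split => // e' e'0; exists setT => //; rewrite /setY setDv setU0 measure0.
suff : <<s G >> `<=` approximable by apply; rewrite -GE.
apply: smallest_sub.
  split; first by rewrite -setCT; exact: approxC.
  - by move=> A aA; rewrite setTD; exact: approxC.
  - by move=> F aF; exact: approxbigU.
move=> B GB; split; first exact: mG.
by move=> e' e'0; exists B => //; rewrite /setY setDv setU0 measure0.
Qed.

End approximation.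

(** * The positive part of a charge as a countable supremum *)

Section jordan_sup.
Context (d : measure_display) (T : measurableType d) (R : realType).
Implicit Types nu : {charge set T -> \bar R}.

Lemma charge_real nu (A : set T) : measurable A -> exists r : R, nu A = r%:E.
Proof. by move=> mA; exists (fine (nu A)); rewrite fineK// fin_num_measure. Qed.

Lemma jordan_posI nu P N (nuPN : hahn_decomposition nu P N) (A : set T) :
  measurable A -> jordan_pos nuPN A = nu (A `&` P).
Proof. by move=> mA; rewrite jordan_posE cjordan_posE /crestr0 mem_set. Qed.

Lemma jordan_negI nu P N (nuPN : hahn_decomposition nu P N) (A : set T) :
  measurable A -> jordan_neg nuPN A = - nu (A `&` N).
Proof. by move=> mA; rewrite jordan_negE cjordan_negE /crestr0 mem_set. Qed.

Lemma jordan_decompB nu P N (nuPN : hahn_decomposition nu P N) (A : set T) :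
  measurable A -> nu A = jordan_pos nuPN A - jordan_neg nuPN A.
Proof. by move=> mA; rewrite (jordan_decomp nuPN mA) /cadd/= cscaleN1. Qed.

(** Each [nu (A & B j)] is at most the positive part of [A & B j], hence of [A]. Conversely the
    positive part is [nu (A & P)], and some [B j] is close to the Hahn set [P] in total variation,
    so [nu (A & B j)] is close to it. *)
Lemma jordan_pos_sup nu P N (nuPN : hahn_decomposition nu P N)
    (B : nat -> set T) (A : set T) :
  @measurable _ T = <<s range B >> -> range B [set: T] ->
  setI_closed (range B) -> setC_closed (range B) -> measurable A ->
  jordan_pos nuPN A = ereal_sup (range (fun j => nu (A `&` B j))).
Proof.
move=> BE BT BI BC mA.
have mB j : measurable (B j) by rewrite BE; apply: sub_gen_smallest; exists j.
have mAB j : measurable (A `&` B j) by exact: measurableI.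
have [[mP _] _ _ _] := nuPN.
apply/eqP; rewrite eq_le; apply/andP; split; last first.
  apply: ge_ereal_sup => _ [j _ <-]; rewrite (jordan_decompB nuPN)//.
  apply: (@le_trans _ _ (jordan_pos nuPN (A `&` B j))).
    by rewrite leeBlDr ?fin_num_measure// leeDl.
  by apply: le_measure; rewrite ?inE.
apply/lee_addgt0Pr => e e0.
have [_ [j _ <-] PB] :=
  measurable_approx (fin_num_measure (charge_variation nuPN)) BE BT BI BC mP e0.
apply: (@le_trans _ _ (nu (A `&` B j) + e%:E)); last first.
  by apply: leeD => //; apply: ereal_sup_ubound; exists j.
have mX : measurable (A `&` (P `\` B j)).
  by apply: measurableI => //; exact: measurableD.
have mY : measurable (A `&` (B j `\` P)).
  by apply: measurableI => //; exact: measurableD.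
have mXY : measurable (P `+` B j) by apply: measurableU; apply: measurableD.
(* The two pieces are disjoint parts of the symmetric difference of [P] and [B j], whose variation
   is below [e]. *)
have hX : `|nu (A `&` (P `\` B j))| + `|nu (A `&` (B j `\` P))| < e%:E.
  apply: le_lt_trans PB.
  apply: (@le_trans _ _ (charge_variation nuPN (A `&` (P `\` B j)) +
    charge_variation nuPN (A `&` (B j `\` P)))).
    by apply: leeD; exact: abse_charge_variation.
  rewrite -measureU//; last first.
    by apply/seteqP; split => x //=; tauto.
  apply: le_measure; rewrite ?inE//; first exact: measurableU.
  by move=> x; rewrite /setY/=; tauto.
(* [A & P] and [A & B j] share the piece [A & P & B j]; only the two small pieces of [hX] differ. *)
rewrite jordan_posI// (chargeDI nu (measurableI _ _ mA mP) (mB j)).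
rewrite (chargeDI nu (mAB j) mP) -[A `&` P `&` B j]setIA.
rewrite -[A `&` B j `&` P]setIA (setIC (B j) P).
have [z ->] := charge_real nu (measurableI _ _ mA (measurableI _ _ mP (mB j))).
move: hX; have -> : A `&` (P `\` B j) = A `&` P `\` B j by rewrite !setDE setIA.
have -> : A `&` (B j `\` P) = A `&` B j `\` P by rewrite !setDE setIA.
have [x ->] := charge_real nu (measurableD (measurableI _ _ mA mP) (mB j)).
have [y ->] := charge_real nu (measurableD (mAB j) mP).
rewrite !abse_EFin -!EFinD lte_fin lee_fin => hX.
have := ler_norm x; have := ler_norm (- y); rewrite normrN; lra.
Qed.

End jordan_sup.

(** * Countable generation of the Borel sets *)

(* The algebra generated by a sequence [G], enumerated: a member is a set of
   words of length [n] in the truth values of [G 0, ..., G n.-1]. *)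
Section countable_algebra.
Context (d : measure_display) (T : measurableType d).
Variable G : nat -> set T.
Hypothesis GE : @measurable _ T = <<s range G >>.

Let word n x : seq bool := mkseq (fun i => `[< G i x >]) n.

Let wordP n (A : set T) := exists Q : pred (seq bool), A = [set x | Q (word n x)].

Let B k : set T :=
  if (unpickle k : option (nat * seq (seq bool))) is Some (n, ws)
  then [set x | word n x \in ws] else set0.

(** There are finitely many words of length [n], so a predicate on them amounts to a finite list,
    which has a natural number as code. Numbers that code nothing give the empty set. *)
Let rangeB : range B = [set A | exists n, wordP n A].
Proof.
apply/seteqP; split => [_ [k _ <-]|A [n [Q ->]]].
  rewrite /B; case: unpickle => [[n ws]|].
    by exists n, (fun w => w \in ws).
  by exists 0%N, xpred0; apply/seteqP; split.
pose ws := [seq w <- [seq val t | t <- enum {: n.-tuple bool}] | Q w].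
exists (pickle (n, ws)) => //.
rewrite /B pickleK; apply/seteqP; split => x /=; rewrite mem_filter.
  by case/andP.
move=> ->/=; apply/mapP.
by exists (tcast (size_mkseq _ _) (in_tuple (word n x)));
  [rewrite mem_enum|rewrite val_tcast].
Qed.

Let wordP_widen m n A : (m <= n)%N -> wordP m A -> wordP n A.
Proof.
move=> mn [Q ->]; exists (fun w => Q (take m w)).
by apply/funext => x /=; rewrite /word /mkseq -map_take take_iota (minn_idPl mn).
Qed.

Lemma countable_algebra : exists B : nat -> set T,
  [/\ @measurable _ T = <<s range B >>, range B [set: T],
    setI_closed (range B) & setC_closed (range B)].
Proof.
have mwordP n A : wordP n A -> measurable A.
  elim: n A => [|n ih] A [Q ->].
    rewrite /word /=; case: (Q [::]).
      by rewrite [X in measurable X](_ : _ = setT)//; apply/seteqP; split.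
    by rewrite [X in measurable X](_ : _ = set0)//; apply/seteqP; split.
  have mGn : measurable (G n).
    by rewrite GE; apply: sub_gen_smallest; exists n.
  (* The last letter of the word records membership in [G n]; fixing it leaves a condition on words
     of length [n]. *)
  rewrite [X in measurable X](_ : _ =
    (G n `&` [set x | Q (rcons (word n x) true)]) `|`
    (~` G n `&` [set x | Q (rcons (word n x) false)])).
    apply: measurableU; apply: measurableI => //; try exact: measurableC.
      by apply: ih; exists (fun w => Q (rcons w true)).
    by apply: ih; exists (fun w => Q (rcons w false)).
  apply/seteqP; split => x /=; rewrite /word mkseqS.
    by case: asboolP => Gx; [left|right].
  by case=> -[Gx]; [rewrite asboolT|rewrite asboolF].
exists B; rewrite rangeB; split.
- apply/seteqP; split.
    rewrite GE; apply: smallest_sub; first exact: smallest_sigma_algebra.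
    move=> _ [n _ <-]; apply: sub_gen_smallest.
    (* [G n] is read off letter [n], which first occurs in words of length [n.+1]. *)
    exists n.+1, (fun w => nth false w n).
    by apply/seteqP; split => x /=; rewrite nth_mkseq// => /asboolP.
  apply: smallest_sub; first exact: sigma_algebra_measurable.
  by move=> A [n] /mwordP.
- by exists 0%N, xpredT; apply/seteqP; split.
- move=> A1 A2 [m hA1] [n hA2].
  have [Q1 ->] := wordP_widen (leq_maxl m n) hA1.
  have [Q2 ->] := wordP_widen (leq_maxr m n) hA2.
  exists (maxn m n), (fun w => Q1 w && Q2 w).
  by apply/seteqP; split => x /= /andP.
- move=> A [n [Q ->]]; exists n, (fun w => ~~ Q w).
  by apply/seteqP; split => x /= /negP.
Qed.

End countable_algebra.

(** The balls of radius [1 / (m + 1)] about the points of a countable dense set form a countable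
    basis, so every open set is a countable union of them. *)
Lemma polish_countably_generated (R : realType) (X : topologicalType) :
  polish R X -> exists G : nat -> set X, <<s range G >> = <<s @open X >>.
Proof.
case=> -[D [/countable_injP[f finj] Dd]] [d [_ dxx dC [dD dO] _]].
have ball_open x (e : R) : open [set y | (d x y < e)%R].
  apply/dO => y /= xy; exists (e - d x y)%R; split; first by lra.
  by move=> z /= yz; have := dD x y z; lra.
(* As [f] is injective on [D], this is the ball about the one point of [D] numbered [n], or empty if
   there is none. *)
pose ball n m : set X :=
  [set y | exists2 x, D x /\ f x = n & (d x y < m.+1%:R^-1)%R].
pose G k : set X :=
  if (unpickle k : option (nat * nat)) is Some (n, m) then ball n m else set0.
exists G; apply/seteqP; split.
  apply: smallest_sub; first exact: smallest_sigma_algebra.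
  move=> _ [k _ <-]; apply: sub_gen_smallest; rewrite /G.
  case: unpickle => [[n m]|]; last exact: open0.
  rewrite (_ : ball n m =
    \bigcup_(x in D `&` [set x | f x = n]) [set y | (d x y < m.+1%:R^-1)%R]).
    exact: bigcup_open.
  by apply/seteqP; split => y [x Dx xy]; exists x.
apply: smallest_sub; first exact: smallest_sigma_algebra.
move=> U oU.
have -> : U = \bigcup_k (if `[< G k `<=` U >] then G k else set0).
  apply/seteqP; split => [y Uy|y [k _]]; last by case: asboolP => // + Gy; apply.
  have [/(_ oU) /(_ _ Uy) [e [e0 yeU]] _] := dO U.
  (* A point [x] of [D] within [1 / (m + 1)] of [y] then has a ball of that radius that contains [y]
     and, having diameter below [e], stays inside [U]. *)
  have [m me] : exists m, (2 * m.+1%:R^-1 < e)%R.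
    exists (Num.truncn (2 / e)); rewrite -ltr_pdivlMl// -invf_div invf_div.
    rewrite -[ltRHS]invrK ltf_pV2 ?posrE ?invr_gt0 ?mulr_gt0 ?invr_gt0//.
    by rewrite invfM invrK mulrC truncnS_gt.
  have : closure D y by rewrite Dd.
  move=> /(_ [set z | (d y z < m.+1%:R^-1)%R]) [].
    apply: open_nbhs_nbhs; split; first exact: ball_open.
    by rewrite /= (dxx y y).2.
  move=> x [Dx /= yx]; exists (pickle (f x, m)) => //.
  rewrite /G pickleK asboolT; first by exists x => //; rewrite dC.
  move=> z [x' [Dx' fx'] xz]; apply: yeU => /=.
  have xx' : x' = x by apply: finj; rewrite ?inE.
  move: yx xz me; rewrite xx'; move: (m.+1%:R^-1)%R => t yx xz me.
  by have := dD y x z; lra.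
have [_ _ sU] := smallest_sigma_algebra setT (range G).
apply: sU => k; case: asboolP => _.
  by apply: sub_gen_smallest; exists k.
by have [] := smallest_sigma_algebra setT (range G).
Qed.

(** * Suprema, integrals and signed measures *)

Lemma bounded_integrable (d : measure_display) (T : measurableType d)
    (R : realType) (mu : {measure set T -> \bar R}) (D : set T)
    (f : T -> \bar R) (M : R) :
  measurable D -> mu D \is a fin_num -> measurable_fun D f ->
  (forall x, D x -> `|f x| <= M%:E) -> mu.-integrable D f.
Proof.
move=> mD muD mf fM; apply/integrableP; split => //.
apply: (@le_lt_trans _ _ (\int[mu]_(x in D) cst (`|M|%:E) x)).
  apply: ge0_le_integral => //; first exact: measurableT_comp.
  by move=> x /fM/le_trans; apply; rewrite lee_fin ler_norm.
by rewrite integral_cst// ltey_eq fin_numM.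
Qed.

Section bounded_convergence.
Context (d : measure_display) (T : measurableType d) (R : realType).
Variable mu : {finite_measure set T -> \bar R}.

Lemma bounded_convergence (D : set T) (f_ : nat -> T -> \bar R) (f : T -> \bar R)
    (M : R) :
  measurable D -> (forall n, measurable_fun D (f_ n)) ->
  (forall n x, D x -> `|f_ n x| <= M%:E) ->
  (forall x, D x -> f_ n x @[n --> \oo] --> f x) ->
  \int[mu]_(x in D) f_ n x @[n --> \oo] --> \int[mu]_(x in D) f x.
Proof.
move=> mD mf_ fM cf.
have [_ _ //] := dominated_convergence mD mf_ (emeasurable_fun_cvg _ _ mf_ cf)
  (aeW _ cf) (finite_measure_integrable_cst mu M mD)
  (aeW _ (fun x n => @fM n x)).
Qed.

End bounded_convergence.

(** * Integrals of countable suprema below an additive set function *)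

Section integral_sup.
Context (d : measure_display) (T : measurableType d) (R : realType).
Variables (mu : {finite_measure set T -> \bar R}) (f : nat -> T -> \bar R).
Variables (M : R) (theta : set T -> \bar R).
Hypotheses (mf : forall j, measurable_fun [set: T] (f j))
  (fM : forall j x, `|f j x| <= M%:E).
Hypothesis thetaU : forall E F, measurable E -> measurable F ->
  E `&` F = set0 -> theta (E `|` F) = theta E + theta F.
Hypothesis f_theta : forall j E, measurable E ->
  \int[mu]_(x in E) f j x <= theta E.

Let Fixpoint g n x : \bar R :=
  if n is m.+1 then maxe (g m x) (f m.+1 x) else f 0%N x.

Let mg n : measurable_fun [set: T] (g n).
Proof. by elim: n => [|n ih] /=; [exact: mf|exact: measurable_maxe]. Qed.

Let gM n x : `|g n x| <= M%:E.
Proof. by elim: n => [|n ih] /=; [|rewrite /maxe; case: ifP]. Qed.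

Let g_cvg x : g n x @[n --> \oo] --> ereal_sup (range (f ^~ x)).
Proof.
have -> : ereal_sup (range (f ^~ x)) = ereal_sup (range (g ^~ x)).
  apply/eqP; rewrite eq_le; apply/andP; split; apply: ge_ereal_sup => _ [n _ <-].
    apply: (@le_trans _ _ (g n x)); last by apply: ereal_sup_ubound; exists n.
    by case: n => [|n] //=; rewrite le_max lexx orbT.
  elim: n => [|n ih] /=; first by apply: ereal_sup_ubound; exists 0%N.
  by rewrite ge_max ih/=; apply: ereal_sup_ubound; exists n.+1.
apply: ereal_nondecreasing_cvgn; apply/nondecreasing_seqP => n /=.
by rewrite le_max lexx.
Qed.

(* The set where [f n.+1] realises the running maximum is measurable, so it can
   be split off from [E]. *)
Let g_theta n E : measurable E -> \int[mu]_(x in E) g n x <= theta E.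
Proof.
elim: n E => [|n ih] E mE /=; first exact: f_theta.
pose F := [set x | g n x < f n.+1 x].
have mF : measurable F.
  by rewrite -[F]setTI; exact: measurable_lte.
have mE1 : measurable (E `&` F) by exact: measurableI.
have mE2 : measurable (E `\` F) by exact: measurableD.
have EU : (E `&` F) `|` (E `\` F) = E by exact: setUIDK.
have E0 : (E `&` F) `&` (E `\` F) = set0.
  by apply/seteqP; split => x //= [[_ ?] [_]].
rewrite -{1}EU integral_setU//; last 2 first.
  by rewrite EU; apply: measurable_funTS; exact: (mg n.+1).
  by apply/disj_setPS; rewrite E0.
have -> : theta E = theta (E `&` F) + theta (E `\` F) by rewrite -thetaU// EU.
rewrite leeD//.
  rewrite (eq_integral (f n.+1)); first exact: f_theta.
  by move=> x; rewrite inE => -[_ /ltW] /max_idPr.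
rewrite (eq_integral (g n)); first exact: ih.
by move=> x; rewrite inE => -[_] /negP; rewrite -leNgt => /max_idPl.
Qed.

(** The running maxima increase to the supremum and are bounded by [M], so the inequality [g_theta]
    passes to the limit by bounded convergence; [theta] itself need only be finitely additive. *)
Lemma le_integral_sup E : measurable E ->
  \int[mu]_(x in E) ereal_sup (range (f ^~ x)) <= theta E.
Proof.
move=> mE; have := @bounded_convergence _ _ _ mu E g _ M mE
  (fun n => measurable_funTS (mg n)) (fun n x _ => gM n x) (fun x _ => @g_cvg x).
move=> /[dup] c /cvg_lim <-//; apply: lime_le.
  by apply/cvg_ex; eexists; exact: c.
by apply: nearW => n; exact: g_theta.
Qed.

End integral_sup.

(** An alias carrying the three proofs as arguments, so that the charge structure declared next can
    be inferred from it. *)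
Definition charge_of_fun (d : measure_display) (T : measurableType d)
    (R : realType) (f : set T -> \bar R) & f set0 = 0
    & (forall A, measurable A -> f A \is a fin_num) & semi_sigma_additive f :=
  f.

HB.instance Definition _ (d : measure_display) (T : measurableType d)
    (R : realType) (f : set T -> \bar R) (f0 : f set0 = 0)
    (ff : forall A, measurable A -> f A \is a fin_num)
    (fs : semi_sigma_additive f) :=
  isCharge.Build d T R (charge_of_fun f0 ff fs) f0 ff fs.

(** Partial sums of the [k x (F i)] are values of [k x] on finite unions, hence bounded by [M]
    uniformly in [x]; bounded convergence does the rest. *)
Lemma kernel_integral_sigma_additive (d d' : measure_display)
    (T : measurableType d) (T' : measurableType d') (R : realType)
    (mu : {finite_measure set T -> \bar R})
    (k : T -> {charge set T' -> \bar R}) (M : R) :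
  (forall A, measurable A -> measurable_fun [set: T] (k ^~ A)) ->
  (forall x A, measurable A -> `|k x A| <= M%:E) ->
  semi_sigma_additive (fun A => \int[mu]_x k x A).
Proof.
move=> mk kM F mF tF mUF.
have mS n : measurable (\big[setU/set0]_(i < n) F i).
  by apply: bigsetU_measurable.
rewrite [X in X @ _ --> _](_ : _ =
    (fun n => \int[mu]_x k x (\big[setU/set0]_(i < n) F i))).
  apply: (@bounded_convergence _ _ _ mu setT _ _ M) => //.
  - by move=> n; exact: mk.
  - by move=> n x _; exact: kM.
  - move=> x _; have := @charge_semi_sigma_additive _ _ _ (k x) F mF tF mUF.
    by under eq_fun do rewrite big_mkord -charge_semi_additive//.
apply/funext => n; rewrite big_mkord -integral_sum//.
  by apply: eq_integral => x _; rewrite charge_semi_additive.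
move=> i; apply: bounded_integrable (mk _ (mF i)) (fun x _ => kM x _ (mF i)) => //.
by rewrite fin_num_measure.
Qed.

Definition csub (d : measure_display) (T : measurableType d) (R : realType)
    (nu1 nu2 : {charge set T -> \bar R}) : {charge set T -> \bar R} :=
  cadd nu1 (cscale (-1) nu2).

Lemma csubE (d : measure_display) (T : measurableType d) (R : realType)
    (nu1 nu2 : {charge set T -> \bar R}) (A : set T) :
  csub nu1 nu2 A = nu1 A - nu2 A.
Proof. by rewrite /csub /= /cadd /= /cscale EFinN mulN1e. Qed.

(** * Setwise limits of increasing sequences of charges *)

Section nondecreasing_charge.
Context (d : measure_display) (T : measurableType d) (R : realType).

Lemma jordan_pos_id (nu : {charge set T -> \bar R}) P N
    (nuPN : hahn_decomposition nu P N) (A : set T) :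
  (forall B, measurable B -> 0 <= nu B) -> measurable A ->
  jordan_pos nuPN A = nu A.
Proof.
move=> nu0 mA; rewrite (jordan_decompB nuPN mA).
suff -> : jordan_neg nuPN A = 0 by rewrite sube0.
have [_ [mN _] _ _] := nuPN.
apply/eqP; rewrite eq_le measure_ge0 andbT jordan_negI// oppe_le0 nu0//.
exact: measurableI.
Qed.

(** The increments are positive, so their series is a measure, finite because it is at most
    [c - m 0]. The limit is [m 0] plus this measure. *)
Lemma charge_nondecreasing_cvg (m : nat -> {charge set T -> \bar R})
    (c : {charge set T -> \bar R}) :
  (forall n A, measurable A -> m n A <= m n.+1 A) ->
  (forall n A, measurable A -> m n A <= c A) ->
  exists l : {charge set T -> \bar R},
    forall A, measurable A -> m n A @[n --> \oo] --> l A.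
Proof.
move=> m_nd m_c.
pose D n := csub (m n.+1) (m n).
have D0 n B : measurable B -> 0 <= D n B.
  by move=> mB; rewrite csubE sube_ge0 ?m_nd// fin_num_measure.
pose DPN n := projT2 (cid (projT2 (cid (Hahn_decomposition (D n))))).
(* Taking the positive part turns the positive charge [D n] into a measure with the same values on
   measurable sets. *)
pose p n : {measure set T -> \bar R} := jordan_pos (DPN n).
have pE n A : measurable A -> p n A = D n A.
  by move=> mA; exact: (jordan_pos_id (DPN n) (D0 n) mA).
have sumE n A : measurable A -> \sum_(0 <= i < n) p i A = m n A - m 0%N A.
  move=> mA; rewrite (eq_bigr (fun i => m i.+1 A - m i A)).
    by rewrite telescope_sume// => i _; rewrite fin_num_measure.
  by move=> i _; rewrite pE// csubE.
have pF A : measurable A -> mseries p 0 A \is a fin_num.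
  move=> mA; rewrite ge0_fin_numE//.
  apply: (@le_lt_trans _ _ (c A - m 0%N A)); last first.
    by rewrite ltey_eq fin_numB !fin_num_measure.
  apply: lime_le; first exact: is_cvg_nneseries.
  by apply: nearW => n; rewrite sumE// leeB// m_c.
pose q : {charge set T -> \bar R} :=
  charge_of_fun (measure0 (mseries p 0)) pF
    (@measure_semi_sigma_additive _ _ _ (mseries p 0)).
exists (cadd (m 0%N) q) => A mA.
rewrite (_ : (fun n => m n A) = fun n => m 0%N A + \sum_(0 <= i < n) p i A).
  apply: cvgeD; [by rewrite fin_num_adde_defr// fin_num_measure|exact: cvg_cst|].
  exact: is_cvg_nneseries.
by apply/funext => n; rewrite sumE// addeC subeK// fin_num_measure.
Qed.

End nondecreasing_charge.

(** * Integration against a signed measure *)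

Lemma integral_mscale (d : measure_display) (T : measurableType d)
    (R : realType) (m : {measure set T -> \bar R}) (k : {nonneg R})
    (f : T -> \bar R) : m.-integrable [set: T] f ->
  \int[mscale k m]_x f x = k%:num%:E * \int[m]_x f x.
Proof.
move=> fi; have mf := measurable_int _ fi.
have pfin := integrable_fin_num measurableT (integrable_funepos measurableT fi).
have nfin := integrable_fin_num measurableT (integrable_funeneg measurableT fi).
have mp := measurable_funepos mf; have mn := measurable_funeneg mf.
rewrite [LHS]integralE (ge0_integral_mscale m measurableT k mp)//.
rewrite (ge0_integral_mscale m measurableT k mn)// -muleBr//.
  by rewrite -integralE.
exact: fin_num_adde_defr.
Qed.

Lemma integral_mrestr (d : measure_display) (T : measurableType d)
    (R : realType) (m : {measure set T -> \bar R}) (E : set T)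
    (mE : measurable E) (f : T -> \bar R) : measurable_fun [set: T] f ->
  \int[mrestr m mE]_x f x = \int[m]_(x in E) f x.
Proof.
move=> mf; have mEC := measurableC mE.
rewrite -(setvU E) setUC integral_setU//; last 2 first.
- exact: measurable_funTS.
- exact/disj_setPCl.
rewrite (eq_measure_integral m); last first.
  by move=> A mA AE; rewrite /= /mrestr setIidl.
rewrite (eq_measure_integral mzero (D := ~` E)).
  by rewrite integral_measure_zero adde0.
move=> A mA AE /=; rewrite /mrestr (_ : A `&` E = set0) ?measure0//.
by apply/disjoints_subset.
Qed.

Section signed_integral.
Context (R : realType) (X : ptopologicalType).
Implicit Types (mu nu : SM R X) (f : Borel X -> \bar R).

Lemma jordan_pos_fin mu (A : set (Borel X)) : measurable A ->
  jordan_pos (hahnPN mu) A \is a fin_num.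
Proof. exact: fin_num_measure. Qed.

Lemma jordan_neg_fin mu (A : set (Borel X)) : measurable A ->
  jordan_neg (hahnPN mu) A \is a fin_num.
Proof. exact: fin_num_measure. Qed.

Lemma jordan_integrable mu f (M : R) : measurable_fun [set: Borel X] f ->
  (forall x, `|f x| <= M%:E) ->
  (jordan_pos (hahnPN mu)).-integrable [set: Borel X] f /\
  (jordan_neg (hahnPN mu)).-integrable [set: Borel X] f.
Proof.
move=> mf fM; split; apply: (bounded_integrable (M := M)) => //.
  exact: jordan_pos_fin.
exact: jordan_neg_fin.
Qed.

Lemma sintegral_fin_num mu f (M : R) : measurable_fun [set: Borel X] f ->
  (forall x, `|f x| <= M%:E) -> sintegral mu f \is a fin_num.
Proof.
move=> mf fM; have [ip i_n] := jordan_integrable mu mf fM.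
by rewrite fin_numB; apply/andP; split; exact: integrable_fin_num.
Qed.

(** The integral does not depend on how [mu] is written as a difference of finite measures: with
    Jordan parts [p] and [n], the measures [p + b] and [a + n] coincide, and so do their integrals
    of [f]. Linearity in [mu] rests on this. *)
Lemma sintegral_decomp mu (a b : {measure set (Borel X) -> \bar R}) f (M : R) :
  fin_num_fun a -> fin_num_fun b ->
  (forall A, measurable A -> mu A = a A - b A) ->
  measurable_fun [set: Borel X] f -> (forall x, `|f x| <= M%:E) ->
  sintegral mu f = \int[a]_x f x - \int[b]_x f x.
Proof.
move=> aF bF muE mf fM.
set p := jordan_pos (hahnPN mu); set n := jordan_neg (hahnPN mu).
have ia : a.-integrable setT f.
  by apply: (bounded_integrable (M := M)) => //; exact: aF.
have ib : b.-integrable setT f.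
  by apply: (bounded_integrable (M := M)) => //; exact: bF.
have [ip i_n] := jordan_integrable mu mf fM.
have : \int[measure_add p b]_x f x = \int[measure_add a n]_x f x.
  apply: eq_measure_integral => A mA _.
  rewrite [LHS]measure_addE [RHS]measure_addE /p /n /=.
  have := muE A mA; rewrite (jordan_decompB (hahnPN mu) mA).
  rewrite -(fineK (aF _ mA)) -(fineK (bF _ mA)).
  rewrite -(fineK (jordan_pos_fin mu mA)) -(fineK (jordan_neg_fin mu mA)).
  by rewrite -!EFinB -!EFinD => -[h]; congr EFin; lra.
rewrite !integral_measure_add// /sintegral -/p -/n.
rewrite -(fineK (integrable_fin_num _ ia))// -(fineK (integrable_fin_num _ ib))//.
rewrite -(fineK (integrable_fin_num _ ip))// -(fineK (integrable_fin_num _ i_n))//.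
by rewrite -!EFinB -!EFinD => -[h]; congr EFin; lra.
Qed.

Lemma sintegral_positive mu f (M : R) : positive_sm mu ->
  measurable_fun [set: Borel X] f -> (forall x, `|f x| <= M%:E) ->
  sintegral mu f = \int[jordan_pos (hahnPN mu)]_x f x.
Proof.
move=> mu0 mf fM.
rewrite (sintegral_decomp (a := jordan_pos (hahnPN mu)) (b := mzero)
  (@jordan_pos_fin mu) _ _ mf fM).
- by rewrite integral_measure_zero sube0.
- by [].
- by move=> A mA; rewrite sube0; apply/esym; exact: jordan_pos_id.
Qed.

Lemma sintegral_add mu nu f (M : R) :
  measurable_fun [set: Borel X] f -> (forall x, `|f x| <= M%:E) ->
  sintegral (cadd mu nu) f = sintegral mu f + sintegral nu f.
Proof.
move=> mf fM.
have [ip i_n] := jordan_integrable mu mf fM.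
have [ip' i_n'] := jordan_integrable nu mf fM.
have aF : fin_num_fun
    (measure_add (jordan_pos (hahnPN mu)) (jordan_pos (hahnPN nu))).
  by move=> A mA; rewrite measure_addE fin_numD !fin_num_measure.
have bF : fin_num_fun
    (measure_add (jordan_neg (hahnPN mu)) (jordan_neg (hahnPN nu))).
  by move=> A mA; rewrite measure_addE fin_numD !fin_num_measure.
rewrite (sintegral_decomp aF bF _ mf fM).
  rewrite !integral_measure_add// /sintegral oppeD; first by rewrite addeACA.
  by rewrite fin_num_adde_defr// integrable_fin_num.
move=> A mA; rewrite [X in _ = X - _]measure_addE [X in _ = _ - X]measure_addE.
rewrite /= /cadd (jordan_decompB (hahnPN mu) mA) (jordan_decompB (hahnPN nu) mA).
rewrite oppeD; first by rewrite addeACA.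
by rewrite fin_num_adde_defr// jordan_neg_fin.
Qed.

Lemma sintegral_scale mu f (M r : R) :
  measurable_fun [set: Borel X] f -> (forall x, `|f x| <= M%:E) ->
  sintegral (cscale r mu) f = r%:E * sintegral mu f.
Proof.
move=> mf fM; set p := jordan_pos (hahnPN mu); set n := jordan_neg (hahnPN mu).
have [ip i_n] := jordan_integrable mu mf fM.
pose k := NngNum (normr_ge0 r).
have pF : fin_num_fun (mscale k p).
  by move=> A mA; rewrite /= /mscale fin_numM// jordan_pos_fin.
have nF : fin_num_fun (mscale k n).
  by move=> A mA; rewrite /= /mscale fin_numM// jordan_neg_fin.
have muE A : measurable A -> cscale r mu A = r%:E * (p A - n A).
  by move=> mA; rewrite /= /cscale (jordan_decompB (hahnPN mu) mA).
have -> : sintegral mu f = \int[p]_x f x - \int[n]_x f x by [].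
rewrite muleBr//; last first.
  by rewrite fin_num_adde_defr// integrable_fin_num.
have [r0|r0] := leP 0%R r.
- rewrite (sintegral_decomp pF nF _ mf fM).
    by rewrite !integral_mscale//= ger0_norm.
  move=> A mA; rewrite [LHS]muE// /= /mscale /= ger0_norm// muleBr//.
  by rewrite fin_num_adde_defr// jordan_pos_fin.
(* A negative factor exchanges the roles of the two Jordan parts. *)
- rewrite (sintegral_decomp nF pF _ mf fM).
    by rewrite !integral_mscale//= ltr0_norm// addeC EFinN !mulNe oppeK.
  move=> A mA; rewrite [LHS]muE// /= /mscale /= ltr0_norm// EFinN !mulNe oppeK.
  rewrite muleBr//; first by rewrite addeC.
  by rewrite fin_num_adde_defr// jordan_pos_fin.
Qed.

Lemma sintegral_bound mu f (M : R) :
  measurable_fun [set: Borel X] f -> (forall x, `|f x| <= M%:E) ->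
  `|sintegral mu f| <= M%:E * tvnorm mu.
Proof.
move=> mf fM.
(* The space is pointed, so the bound on [f] is not vacuous. *)
have M0 : (0 <= M)%R by have := le_trans (abse_ge0 _) (fM point).
have bound (m : {measure set (Borel X) -> \bar R}) :
    `|\int[m]_x f x| <= M%:E * m setT.
  apply: le_trans (le_abse_integral _ _ _) _ => //.
  rewrite -integral_cst//; apply: ge0_le_integral => //.
  exact: measurableT_comp.
rewrite /sintegral /tvnorm /charge_variation ge0_muleDr//.
by apply: le_trans (lee_abs_sub _ _) _; apply: leeD; exact: bound.
Qed.

Lemma charge_tvnorm mu (A : set (Borel X)) : measurable A ->
  `|mu A| <= tvnorm mu.
Proof.
move=> mA; apply: le_trans (abse_charge_variation (hahnPN mu) mA) _.
by apply: le_measure; rewrite ?inE.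
Qed.

(** The total variation is [mu P - mu N] for a Hahn decomposition, two values of size at most
    [M]. *)
Lemma tvnorm_le mu (M : R) : (forall A, measurable A -> `|mu A| <= M%:E) ->
  tvnorm mu <= (M + M)%:E.
Proof.
move=> muM; have [[mP _] [mN _] _ _] := hahnPN mu.
rewrite /tvnorm /charge_variation jordan_posI// jordan_negI// EFinD leeD//.
  by apply: le_trans (lee_abs _) _; apply: muM; exact: measurableI.
by apply: le_trans (lee_abs _) _; rewrite abseN; apply: muM; exact: measurableI.
Qed.

Lemma tvnorm_positive mu : positive_sm mu -> tvnorm mu = mu setT.
Proof.
move=> mu0; have := jordan_decompB (hahnPN mu) measurableT.
rewrite /tvnorm /charge_variation jordan_pos_id//.
rewrite -(fineK (jordan_neg_fin mu measurableT)).
have [r ->] := charge_real mu (@measurableT _ (Borel X)).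
by rewrite -EFinB -EFinD => -[h]; congr EFin; lra.
Qed.

Definition dirac_sm (x : Borel X) : SM R X := charge_of_finite_measure (dirac x).

Lemma positive_dirac_sm x : positive_sm (dirac_sm x).
Proof. by move=> A mA; exact: measure_ge0. Qed.

Lemma tvnorm_dirac_sm x : tvnorm (dirac_sm x) = 1.
Proof.
rewrite tvnorm_positive; last exact: positive_dirac_sm.
exact: probability_setT.
Qed.

Lemma sintegral_dirac_sm x f (M : R) :
  measurable_fun [set: Borel X] f -> (forall x, `|f x| <= M%:E) ->
  sintegral (dirac_sm x) f = f x.
Proof.
move=> mf fM; rewrite (sintegral_decomp (a := dirac x) (b := mzero) _ _ _ mf fM).
- by rewrite integral_dirac// integral_measure_zero diracT mul1e sube0.
- by move=> A mA; exact: fin_num_measure.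
- by [].
- by move=> A mA; rewrite sube0.
Qed.

End signed_integral.

(** * Operators and kernels *)

Section operators.
Context (R : realType) (X : ptopologicalType).
Implicit Types (mu nu : SM R X) (V : op R X) (k : Borel X -> SM R X).

(* An operator takes functions on all sets; boundedness makes it blind to their
   values on non-measurable ones. *)
Lemma bounded_op_ext V mu nu : bounded_op V ->
  (forall A, measurable A -> mu A = nu A) ->
  forall A, measurable A -> V mu A = V nu A.
Proof.
move=> [Vl [C VC]] munu A mA.
pose l : SM R X := cadd (cscale 1 mu) (cscale (-1) nu).
have VlE : V l A = 1%:E * V mu A + (-1)%:E * V nu A by exact: Vl.
have l0 : tvnorm l = 0.
  have lE B : measurable B -> l B = 0.
    move=> mB; rewrite /l /= /cadd /= /cscale munu// mul1e EFinN mulN1e.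
    by rewrite subee// fin_num_measure.
  rewrite tvnorm_positive; first exact: lE.
  by move=> B mB; rewrite lE.
have := charge_tvnorm (V l) mA; rewrite VlE => /le_trans/(_ (VC l)).
rewrite l0 mule0 mul1e EFinN mulN1e.
have [x ->] := charge_real (V mu) mA; have [y ->] := charge_real (V nu) mA.
by rewrite -EFinB abse_EFin lee_fin normr_le0 subr_eq0 => /eqP ->.
Qed.

(** Total in [E], so that it yields a set function; the value [mu] at a non-measurable [E] is a mere
    default. *)
Definition restr_sm mu (E : set (Borel X)) : SM R X :=
  if pselect (measurable E) is left mE then crestr0 mu mE else mu.

Lemma restr_smE mu (E A : set (Borel X)) : measurable E -> measurable A ->
  restr_sm mu E A = mu (A `&` E).
Proof.
move=> mE mA; rewrite /restr_sm; case: pselect => //= ?.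
by rewrite /crestr0 mem_set.
Qed.

Lemma positive_restr_sm mu (E : set (Borel X)) : measurable E ->
  positive_sm mu -> positive_sm (restr_sm mu E).
Proof. by move=> mE mu0 A mA; rewrite restr_smE// mu0//; exact: measurableI. Qed.

Lemma sintegral_restr_sm mu (E : set (Borel X)) (f : Borel X -> \bar R) (M : R) :
  measurable E -> positive_sm mu ->
  measurable_fun [set: Borel X] f -> (forall x, `|f x| <= M%:E) ->
  sintegral (restr_sm mu E) f = \int[jordan_pos (hahnPN mu)]_(x in E) f x.
Proof.
move=> mE mu0 mf fM.
rewrite (sintegral_decomp (a := mrestr (jordan_pos (hahnPN mu)) mE) (b := mzero)
  _ _ _ mf fM).
- by rewrite integral_mrestr// integral_measure_zero sube0.
- by move=> A mA; rewrite fin_num_measure.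
- by [].
- move=> A mA; rewrite restr_smE// sube0 /= /mrestr jordan_pos_id//.
  exact: measurableI.
Qed.

(** This additivity lets an operator without a kernel play the role of [theta] in
    [le_integral_sup]. *)
Lemma bounded_op_restrU V mu (E F A : set (Borel X)) : bounded_op V ->
  measurable E -> measurable F -> E `&` F = set0 -> measurable A ->
  V (restr_sm mu (E `|` F)) A = V (restr_sm mu E) A + V (restr_sm mu F) A.
Proof.
move=> Vb mE mF EF0 mA; have [Vl _] := Vb.
have := Vl 1%R 1%R (restr_sm mu E) (restr_sm mu F) A mA.
rewrite !mul1e => <-; apply: bounded_op_ext => // B mB.
rewrite restr_smE//; last exact: measurableU.
rewrite /= /cadd /= /cscale !mul1e !restr_smE// setIUr chargeU//.
- exact: measurableI.
- exact: measurableI.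
- by rewrite setIACA EF0 setI0.
Qed.

Lemma bounded_kernel_measurable k : bounded_kernel k ->
  forall A : set (Borel X), measurable A ->
    measurable_fun [set: Borel X] (fun x => k x A).
Proof. by move=> [+ _]; exact. Qed.

Lemma bounded_kernel_bound k : bounded_kernel k ->
  exists M : R, forall x A, measurable A -> `|k x A| <= M%:E.
Proof.
move=> [_ [M kM]]; exists M => x A mA.
exact: le_trans (charge_tvnorm _ mA) (kM x).
Qed.

Lemma bounded_kernelP k (M : R) :
  (forall A, measurable A -> measurable_fun [set: Borel X] (fun x => k x A)) ->
  (forall x A, measurable A -> `|k x A| <= M%:E) -> bounded_kernel k.
Proof.
by move=> mk kM; split => //; exists (M + M)%R => x; apply: tvnorm_le; exact: kM.
Qed.

(** * The operator of a bounded kernel *)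

Section kernel_operator.
Variables (k : Borel X -> SM R X) (kb : bounded_kernel k).

Let mk := bounded_kernel_measurable kb.

Let kop0 mu : sintegral mu (fun x => k x set0) = 0.
Proof.
rewrite /sintegral !integral0_eq ?subee// => x _; exact: charge0.
Qed.

Let kopF mu A : measurable A -> sintegral mu (fun x => k x A) \is a fin_num.
Proof.
move=> mA; have [M kM] := bounded_kernel_bound kb.
by apply: (sintegral_fin_num (M := M) mu (mk mA)) => x; exact: kM.
Qed.

Let kopS mu : semi_sigma_additive (fun A => sintegral mu (fun x => k x A)).
Proof.
move=> F mF tF mUF; have [M kM] := bounded_kernel_bound kb.
have [ip i_n] := jordan_integrable mu (mk mUF) (fun x => kM x _ mUF).
rewrite [X in X @ _ --> _](_ : _ = fun n =>
  (\sum_(0 <= i < n) \int[jordan_pos (hahnPN mu)]_x k x (F i)) -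
  (\sum_(0 <= i < n) \int[jordan_neg (hahnPN mu)]_x k x (F i))).
  apply: cvgeB.
  - by rewrite fin_num_adde_defr// integrable_fin_num.
  - exact: (@kernel_integral_sigma_additive _ _ _ _ _ _ k M mk kM F mF tF mUF).
  - exact: (@kernel_integral_sigma_additive _ _ _ _ _ _ k M mk kM F mF tF mUF).
apply/funext => n; rewrite /sintegral big_split /= sumeN// => i j _ _.
have [_ i_n'] := jordan_integrable mu (mk (mF i)) (fun x => kM x _ (mF i)).
by rewrite fin_num_adde_defr// integrable_fin_num.
Qed.

Definition kernel_op : op R X := fun mu =>
  charge_of_fun (kop0 mu) (@kopF mu) (@kopS mu).

Lemma kernel_opE mu A : kernel_op mu A = sintegral mu (fun x => k x A).
Proof. by []. Qed.

Lemma kernel_op_weakly_continuous : weakly_continuous kernel_op.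
Proof.
have [M kM] := bounded_kernel_bound kb.
split; last by exists k.
split.
  move=> a b mu nu A mA; rewrite !kernel_opE.
  have kMA x : `|k x A| <= M%:E by exact: kM.
  by rewrite (sintegral_add _ _ (mk mA) kMA) !(sintegral_scale _ _ (mk mA) kMA).
exists (M + M)%R => mu.
have tvE : tvnorm mu = (fine (tvnorm mu))%:E.
  by rewrite fineK// /tvnorm fin_num_measure.
rewrite tvE -EFinM mulrDl; apply: tvnorm_le => A mA.
by rewrite kernel_opE EFinM -tvE; apply: sintegral_bound (mk mA) _ => x; exact: kM.
Qed.

End kernel_operator.

Definition cjoin mu nu : SM R X := cadd nu (jordan_pos (hahnPN (csub mu nu))).

Lemma cjoinE mu nu A :
  cjoin mu nu A = nu A + jordan_pos (hahnPN (csub mu nu)) A.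
Proof. by []. Qed.

Lemma cjoin_ger mu nu A : nu A <= cjoin mu nu A.
Proof. by rewrite cjoinE leeDl. Qed.

Lemma cjoin_gel mu nu A : measurable A -> mu A <= cjoin mu nu A.
Proof.
move=> mA; rewrite cjoinE addeC -leeBlDr ?fin_num_measure// -csubE.
rewrite (jordan_decompB (hahnPN (csub mu nu)) mA).
by rewrite leeBlDr ?fin_num_measure// leeDl.
Qed.

(** With [P] the positive Hahn set of [mu - nu], the join is [mu] on [A & P] and [nu] on the rest of
    [A]; [c] dominates both pieces. *)
Lemma cjoin_le mu nu (c : SM R X) A :
  (forall A, measurable A -> mu A <= c A) ->
  (forall A, measurable A -> nu A <= c A) -> measurable A ->
  cjoin mu nu A <= c A.
Proof.
move=> muc nuc mA; rewrite cjoinE jordan_posI//.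
have [[mP _] _ _ _] := hahnPN (csub mu nu); set P := hahn_P _ in mP *.
have mAP := measurableI _ _ mA mP; have mAD := measurableD mA mP.
rewrite csubE (chargeDI nu mA mP) (chargeDI c mA mP).
have := muc _ mAP; have := nuc _ mAD.
have [x1 ->] := charge_real nu mAP; have [x2 ->] := charge_real nu mAD.
have [y1 ->] := charge_real c mAP; have [y2 ->] := charge_real c mAD.
have [z ->] := charge_real mu mAP.
by rewrite -EFinB -!EFinD !lee_fin; lra.
Qed.

Definition kernel_le k V := forall mu A, positive_sm mu -> measurable A ->
  sintegral mu (fun x => k x A) <= V mu A.

(** * Measurability and leastness of joins of kernels *)

Section countable_basis.
Variable B : nat -> set (Borel X).
Hypotheses (BE : @measurable _ (Borel X) = <<s range B >>)
  (BT : range B [set: Borel X]) (BI : setI_closed (range B))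
  (BC : setC_closed (range B)).

Lemma measurable_jordan_pos k (A : set (Borel X)) :
  (forall A, measurable A -> measurable_fun [set: Borel X] (fun x => k x A)) ->
  measurable A ->
  measurable_fun [set: Borel X] (fun x => jordan_pos (hahnPN (k x)) A).
Proof.
move=> mk mA.
have mB j : measurable (B j) by rewrite BE; apply: sub_gen_smallest; exists j.
rewrite (_ : (fun x => _) = fun x => esups (fun j => k x (A `&` B j)) 0%N).
  apply: (measurable_fun_esups (f := fun j x => k x (A `&` B j))) => j.
  by apply: mk; exact: measurableI.
apply/funext => x; rewrite (jordan_pos_sup _ BE BT BI BC mA) /esups /=.
by congr ereal_sup; apply/seteqP; split => _ [j _ <-]; exists j.
Qed.

Lemma measurable_cjoin k1 k2 (A : set (Borel X)) :
  (forall A, measurable A -> measurable_fun [set: Borel X] (fun x => k1 x A)) ->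
  (forall A, measurable A -> measurable_fun [set: Borel X] (fun x => k2 x A)) ->
  measurable A ->
  measurable_fun [set: Borel X] (fun x => cjoin (k1 x) (k2 x) A).
Proof.
move=> mk1 mk2 mA; apply: emeasurable_funD; first exact: mk2.
apply: (@measurable_jordan_pos (fun x => csub (k1 x) (k2 x))) => // A' mA'.
under eq_fun do rewrite csubE.
by apply: emeasurable_funB; [exact: mk1|exact: mk2].
Qed.

(** After subtracting the integral of [k2], the claim bounds the integral of the positive part of
    [k1 x - k2 x]. That is a countable supremum, to which [le_integral_sup] applies. *)
Lemma cjoin_kernel_le k1 k2 V : bounded_kernel k1 -> bounded_kernel k2 ->
  bounded_op V -> kernel_le k1 V -> kernel_le k2 V ->
  kernel_le (fun x => cjoin (k1 x) (k2 x)) V.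
Proof.
move=> kb1 kb2 Vb k1V k2V mu A mu0 mA.
have mk1 := bounded_kernel_measurable kb1.
have mk2 := bounded_kernel_measurable kb2.
have [M1 kM1] := bounded_kernel_bound kb1.
have [M2 kM2] := bounded_kernel_bound kb2.
have mB j : measurable (B j) by rewrite BE; apply: sub_gen_smallest; exists j.
have mAB j : measurable (A `&` B j) by exact: measurableI.
have mADB j : measurable (A `\` B j) by exact: measurableD.
set p := jordan_pos (hahnPN mu).
pose f j x := csub (k1 x) (k2 x) (A `&` B j).
have mf j : measurable_fun [set: Borel X] (f j).
  rewrite /f; under eq_fun do rewrite csubE.
  by apply: emeasurable_funB; [exact: mk1|exact: mk2].
have fM j x : `|f j x| <= (M1 + M2)%:E.
  rewrite /f csubE EFinD; apply: le_trans (lee_abs_sub _ _) _.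
  by apply: leeD; [exact: kM1|exact: kM2].
have i1 (E A' : set (Borel X)) : measurable E -> measurable A' ->
    p.-integrable E (fun x => k1 x A').
  move=> mE mA'; apply: (bounded_integrable (M := M1)) => //.
  - by rewrite fin_num_measure.
  - by apply: measurable_funTS; exact: mk1.
  - by move=> x _; exact: kM1.
have i2 (E A' : set (Borel X)) : measurable E -> measurable A' ->
    p.-integrable E (fun x => k2 x A').
  move=> mE mA'; apply: (bounded_integrable (M := M2)) => //.
  - by rewrite fin_num_measure.
  - by apply: measurable_funTS; exact: mk2.
  - by move=> x _; exact: kM2.
have le1 (E A' : set (Borel X)) : measurable E -> measurable A' ->
    \int[p]_(x in E) k1 x A' <= V (restr_sm mu E) A'.
  move=> mE mA'; have := k1V _ A' (positive_restr_sm mE mu0) mA'.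
  by rewrite (sintegral_restr_sm mE mu0 (mk1 _ mA') (fun x => kM1 x _ mA')).
have le2 (E A' : set (Borel X)) : measurable E -> measurable A' ->
    \int[p]_(x in E) k2 x A' <= V (restr_sm mu E) A'.
  move=> mE mA'; have := k2V _ A' (positive_restr_sm mE mu0) mA'.
  by rewrite (sintegral_restr_sm mE mu0 (mk2 _ mA') (fun x => kM2 x _ mA')).
(* The excess of [V] over [k2], localised to [E]. *)
pose theta E := V (restr_sm mu E) A - \int[p]_(x in E) k2 x A.
have thetaU E F : measurable E -> measurable F -> E `&` F = set0 ->
    theta (E `|` F) = theta E + theta F.
  move=> mE mF EF0; rewrite /theta bounded_op_restrU// integral_setU//.
  - rewrite oppeD; first by rewrite addeACA.
    by rewrite fin_num_adde_defr// integrable_fin_num// i2.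
  - by apply: measurable_funTS; exact: mk2.
  - by apply/disj_setPS; rewrite EF0.
have f_theta j E : measurable E -> \int[p]_(x in E) f j x <= theta E.
  move=> mE; rewrite /theta.
  under eq_integral do rewrite /f csubE.
  rewrite integralB//; [|exact: i1|exact: i2].
  (* Both [k2] and [V] are split along [B j]: the claim is the sum of [le1] on [A & B j] and [le2]
     on the rest of [A]. *)
  have -> : \int[p]_(x in E) k2 x A =
      \int[p]_(x in E) k2 x (A `\` B j) + \int[p]_(x in E) k2 x (A `&` B j).
    rewrite -integralD//; [|exact: i2|exact: i2].
    by apply: eq_integral => x _; rewrite (chargeDI (k2 x) mA (mB j)).
  rewrite (chargeDI _ mA (mB j)).
  have := le1 _ _ mE (mAB j); have := le2 _ _ mE (mADB j).
  have [x1 ->] := charge_real (V (restr_sm mu E)) (mAB j).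
  have [x2 ->] := charge_real (V (restr_sm mu E)) (mADB j).
  rewrite -(fineK (integrable_fin_num mE (i1 _ _ mE (mAB j)))).
  rewrite -(fineK (integrable_fin_num mE (i2 _ _ mE (mAB j)))).
  rewrite -(fineK (integrable_fin_num mE (i2 _ _ mE (mADB j)))).
  by rewrite -!EFinB !lee_fin; lra.
have := le_integral_sup mf fM thetaU f_theta measurableT.
under eq_integral do
  rewrite -(jordan_pos_sup (hahnPN (csub (k1 _) (k2 _))) BE BT BI BC mA).
rewrite /theta leeBrDr ?integrable_fin_num ?i2//.
rewrite (_ : V (restr_sm mu setT) A = V mu A); last first.
  by apply: bounded_op_ext => // A' mA'; rewrite restr_smE// setIT.
(* It remains to see that the integral of the join is the integral of [k2] plus that of the positive
   part. *)
apply: le_trans.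
have mj : measurable_fun [set: Borel X]
    (fun x => jordan_pos (hahnPN (csub (k1 x) (k2 x))) A).
  apply: (@measurable_jordan_pos (fun x => csub (k1 x) (k2 x))) => // A' mA'.
  under eq_fun do rewrite csubE.
  by apply: emeasurable_funB; [exact: mk1|exact: mk2].
have jM x : `|jordan_pos (hahnPN (csub (k1 x) (k2 x))) A| <= (M1 + M2)%:E.
  have [[mP _] _ _ _] := hahnPN (csub (k1 x) (k2 x)).
  rewrite jordan_posI// csubE EFinD; apply: le_trans (lee_abs_sub _ _) _.
  by apply: leeD; [apply: kM1|apply: kM2]; exact: measurableI.
have mjoin := measurable_cjoin mk1 mk2 mA.
rewrite (sintegral_positive (M := (M1 + M2) + M2) mu0 mjoin); last first.
  move=> x; rewrite cjoinE; apply: le_trans (lee_abs_add _ _) _.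
  by rewrite EFinD addeC; apply: leeD => //; exact: kM2.
have ij : p.-integrable setT
    (fun x => jordan_pos (hahnPN (csub (k1 x) (k2 x))) A).
  apply: (bounded_integrable (M := (M1 + M2)%R)) => //.
  by rewrite fin_num_measure.
have -> : \int[p]_x cjoin (k1 x) (k2 x) A =
    \int[p]_x k2 x A + \int[p]_x jordan_pos (hahnPN (csub (k1 x) (k2 x))) A.
  exact: (integralD measurableT (i2 _ _ measurableT mA) ij).
by rewrite addeC.
Qed.

End countable_basis.
End operators.

(** * The supremum of a sequence *)

(** Point masses have norm 1, so the norm bound of [V] serves for all [x] at once. *)
Lemma bounded_op_dirac_bound (R : realType) (X : ptopologicalType)
    (V : op R X) : bounded_op V ->
  exists C : R, forall x A, measurable A -> `|V (dirac_sm R x) A| <= C%:E.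
Proof.
move=> [_ [C VC]]; exists C => x A mA.
apply: le_trans (charge_tvnorm _ mA) _.
by have := VC (dirac_sm R x); rewrite tvnorm_dirac_sm mule1.
Qed.

Lemma kernel_le_cvg (R : realType) (X : ptopologicalType)
    (m : nat -> Borel X -> SM R X) (l : Borel X -> SM R X) (V : op R X) (M : R) :
  (forall n, bounded_kernel (m n)) -> bounded_kernel l ->
  (forall n x A, measurable A -> `|m n x A| <= M%:E) ->
  (forall x A, measurable A -> m n x A @[n --> \oo] --> l x A) ->
  (forall n, kernel_le (m n) V) -> kernel_le l V.
Proof.
move=> mb lb mM ml mV mu A mu0 mA.
have [L lL] := bounded_kernel_bound lb.
rewrite (sintegral_positive mu0 (bounded_kernel_measurable lb mA)
  (fun x => lL x _ mA)).
have cvgI : \int[jordan_pos (hahnPN mu)]_x m n x A @[n --> \oo] -->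
    \int[jordan_pos (hahnPN mu)]_x l x A.
  apply: (@bounded_convergence _ _ _ _ setT (fun n x => m n x A) _ M) => //.
  - by move=> n; exact: bounded_kernel_measurable.
  - by move=> n x _; exact: mM.
  - by move=> x _; exact: ml.
rewrite -(cvg_lim _ cvgI)//.
apply: lime_le; first by apply/cvg_ex; eexists; exact: cvgI.
apply: nearW => n; apply: le_trans (mV n mu A mu0 mA).
by rewrite (sintegral_positive mu0 (bounded_kernel_measurable (mb n) mA)
  (fun x => mM n x _ mA)).
Qed.

Theorem theorem3p6 (R : realType) (X : ptopologicalType)
  (Tn : nat -> op R X) :
  polish R X ->
  (forall n, weakly_continuous (Tn n)) ->
  (exists Rl Su : op R X, bounded_op Rl /\ bounded_op Su /\
     forall n, op_le Rl (Tn n) /\ op_le (Tn n) Su) ->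
  exists U : op R X, is_sup_op Tn U /\ weakly_continuous U.
Proof.
move=> polX Twc [Rl [Su [Rb [Sb TRS]]]].
have [G GE] := polish_countably_generated polX.
have [B [BE BT BI BC]] := @countable_algebra _ (Borel X) G (esym GE).
have /choice[k kP] : forall n, exists k : Borel X -> SM R X,
    bounded_kernel k /\ forall (mu : SM R X) A, measurable A ->
      Tn n mu A = sintegral mu (fun x => k x A).
  by move=> n; have [_] := Twc n.
have kb n : bounded_kernel (k n) by have [] := kP n.
have TE n (mu : SM R X) A : measurable A ->
    Tn n mu A = sintegral mu (fun x => k n x A) by have [_] := kP n; exact.
(* Testing on point masses recovers the kernel, so the operator bounds [Rl] and [Su] become bounds
   on kernels. *)
have kE n x A : measurable A -> k n x A = Tn n (dirac_sm R x) A.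
  move=> mA; have [M kM] := bounded_kernel_bound (kb n).
  by rewrite TE// (sintegral_dirac_sm _ (bounded_kernel_measurable (kb n) mA)
    (fun x => kM x _ mA)).
pose m := fix m n : Borel X -> SM R X :=
  if n is n'.+1 then fun x => cjoin (k n'.+1 x) (m n' x) else k 0%N.
have m_nd n x A : measurable A -> m n x A <= m n.+1 x A.
  by move=> mA; exact: cjoin_ger.
have k_m n x A : measurable A -> k n x A <= m n x A.
  by case: n => [|n] mA //; exact: cjoin_gel.
have R_m n x A : measurable A -> Rl (dirac_sm R x) A <= m n x A.
  move=> mA; elim: n => [|n /le_trans]; last by apply; exact: m_nd.
  by rewrite /= kE//; apply: (TRS 0%N).1 => //; exact: positive_dirac_sm.
(* [Su] at the point mass dominates every [k j x], hence also their joins, by [cjoin_le]. *)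
have m_S n x A : measurable A -> m n x A <= Su (dirac_sm R x) A.
  have kS j A' : measurable A' -> k j x A' <= Su (dirac_sm R x) A'.
    by move=> mA'; rewrite kE//; apply: (TRS j).2 => //; exact: positive_dirac_sm.
  elim: n A => [|n ih] A mA; first exact: kS.
  by apply: cjoin_le => // A'; exact: kS.
have [CR RC] := bounded_op_dirac_bound Rb.
have [CS SC] := bounded_op_dirac_bound Sb.
(* A value between two numbers of size at most [CR] and [CS] has size at most [CR + CS]; this bounds
   all [m n] and the limit uniformly. *)
pose M := (CR + CS)%R.
have between (x : Borel X) A (v : \bar R) : measurable A ->
    Rl (dirac_sm R x) A <= v -> v <= Su (dirac_sm R x) A -> `|v| <= M%:E.
  move=> mA; have := RC x A mA; have := SC x A mA.
  have [r ->] := charge_real (Rl (dirac_sm R x)) mA.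
  have [s ->] := charge_real (Su (dirac_sm R x)) mA.
  case: v => [v| |]; rewrite ?leye_eq ?leeNy_eq//=.
  rewrite !lee_fin /M => sC rC rv vs.
  rewrite ler_norml; move: sC rC; rewrite !ler_norml => /andP[? ?] /andP[? ?].
  by apply/andP; split; lra.
have mM n x A : measurable A -> `|m n x A| <= M%:E.
  by move=> mA; apply: (@between x A) => //; [exact: R_m|exact: m_S].
have mb n : bounded_kernel (m n).
  apply: (bounded_kernelP (M := M)); last by move=> x A; exact: mM.
  elim: n => [|n ih]; first exact: (bounded_kernel_measurable (kb 0%N)).
  move=> A mA; apply: (measurable_cjoin BE BT BI BC) => //.
  exact: (bounded_kernel_measurable (kb n.+1)).
have /choice[l lP] : forall x, exists l : SM R X,
    forall A, measurable A -> m n x A @[n --> \oo] --> l A.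
  move=> x; apply: (@charge_nondecreasing_cvg _ _ _ (fun n => m n x)
    (Su (dirac_sm R x))) => n A mA; [exact: m_nd|exact: m_S].
have m_l n x A : measurable A -> m n x A <= l x A.
  move=> mA; rewrite -(cvg_lim _ (lP x A mA))//.
  have /ereal_nondecreasing_cvgn : nondecreasing_seq (fun n => m n x A).
    by apply/nondecreasing_seqP => j; exact: m_nd.
  by move=> /cvg_lim -> //; apply: ereal_sup_ubound; exists n.
have lb : bounded_kernel l.
  apply: (bounded_kernelP (M := M)) => [A mA|x A mA].
    apply: (emeasurable_fun_cvg (fun n x => m n x A)).
      by move=> n; exact: bounded_kernel_measurable.
    by move=> x _; exact: lP.
  apply: (@between x A) => //.
    by apply: le_trans (m_l 0%N x A mA); exact: R_m.
  rewrite -(cvg_lim _ (lP x A mA))//.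
  apply: lime_le; first by apply/cvg_ex; eexists; exact: (lP x A mA).
  by apply: nearW => n; exact: m_S.
have [Ub Uk] := kernel_op_weakly_continuous lb.
(* The upper bound property holds already pointwise, since [k n x <= m n x <= l x]. *)
exists (kernel_op lb); split => //; split => // [n mu mu0 A mA|V Vb TV mu mu0 A mA].
  have [K kK] := bounded_kernel_bound (kb n).
  have [L lL] := bounded_kernel_bound lb.
  have mk := bounded_kernel_measurable (kb n) mA.
  have ml := bounded_kernel_measurable lb mA.
  rewrite kernel_opE TE// (sintegral_positive mu0 mk (fun x => kK x _ mA)).
  rewrite (sintegral_positive mu0 ml (fun x => lL x _ mA)).
  apply: le_integral => //.
  - by have [] := jordan_integrable mu mk (fun x => kK x _ mA).
  - by have [] := jordan_integrable mu ml (fun x => lL x _ mA).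
  - by move=> x _; exact: le_trans (k_m n x A mA) (m_l n x A mA).
(* For leastness, [V] dominates each [k n], then by induction each partial join [m n], and finally
   the limit [l]. *)
have kV n : kernel_le (k n) V.
  by move=> nu A' nu0 mA'; rewrite -TE//; exact: TV.
rewrite kernel_opE; apply: (kernel_le_cvg mb lb mM) => // n.
by elim: n => [|n ih]; [exact: kV|exact: (cjoin_kernel_le BE BT BI BC)].
Qed.
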